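(* For each $n$ that is an even power of $2$, there is a bipartite graph $G$ such that $p(G)=n+1$ and $\hat{p}(G)>n-\log_2 n+(\log_2 n)^2/4$.
   Context: An edge-coloring assigns a color to each edge. Given an edge-coloring, a path (respectively walk) is a parity path (parity walk) if every color appears an even number of times on it (for walks, counted with multiplicity along the traversal); a walk is open if its endpoints are distinct. A parity edge-coloring is an edge-coloring with no parity path, and $p(G)$ is the minimum number of colors in one. A strong parity edge-coloring is an edge-coloring with no open parity walk, and $\hat{p}(G)$ is the minimum number of colors in one. *)

(* Defs.v *)
From HB Require Import structures.
From mathcomp Require Import all_boot all_order all_algebra.
From mathcomp Require Import boolp.

Set Implicit Arguments.
Unset Strict Implicit.
Unset Printing Implicit Defensive.

Record sgraph := SGraph {
  vertex :> finType;
  adj : rel vertex;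
  adj_sym : symmetric adj;
  adj_irr : irreflexive adj }.

Definition bipartite (G : sgraph) : Prop :=
  exists A : {set G}, forall x y : G, adj x y -> (x \in A) != (y \in A).

Definition edges (G : sgraph) : {set {set G}} :=
  [set [set p.1; p.2] | p : G * G & adj p.1 p.2].

(* An edge-coloring is a map [c : {set G} -> nat], of which only the values
   on [edges G] matter: the edges of a walk of [G] are all in [edges G], and
   [num_colors] counts the colors that occur on [edges G]. *)
Definition num_colors (G : sgraph) (c : {set G} -> nat) : nat :=
  size (undup [seq c f | f <- enum (edges G)]).

(* The walk with vertex sequence [x :: s] is given by [path (@adj G) x s]. *)
Definition walk_edges (G : sgraph) (x : G) (s : seq G) : seq {set G} :=
  pairmap (fun u v => [set u; v]) x s.

Definition even_colors (G : sgraph) (c : {set G} -> nat)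
    (x : G) (s : seq G) : Prop :=
  forall a : nat, ~~ odd (count_mem a [seq c f | f <- walk_edges x s]).

(* The path with a single vertex uses every color zero times; paths are
   therefore required to have at least one edge. *)
Definition parity_path (G : sgraph) (c : {set G} -> nat)
    (x : G) (s : seq G) : Prop :=
  [/\ path (@adj G) x s, uniq (x :: s), s != [::] & even_colors c x s].

Definition open_parity_walk (G : sgraph) (c : {set G} -> nat)
    (x : G) (s : seq G) : Prop :=
  [/\ path (@adj G) x s, x != last x s & even_colors c x s].

Definition parity_coloring (G : sgraph) (c : {set G} -> nat) : Prop :=
  forall (x : G) (s : seq G), ~ parity_path c x s.

Definition strong_parity_coloring (G : sgraph) (c : {set G} -> nat) : Prop :=
  forall (x : G) (s : seq G), ~ open_parity_walk c x s.

Lemma strong_parity_coloringW (G : sgraph) (c : {set G} -> nat) :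
  strong_parity_coloring c -> parity_coloring c.
Proof.
move=> cS x s [xs /= /andP[xNs _] s0 ev]; apply: (cS x s); split=> //.
case: s s0 xNs {xs ev} => // y s _ xNs /=.
by apply: contraNneq xNs => ->; exact: mem_last.
Qed.

Lemma odd_walk_degree (G : sgraph) (v x : G) (s : seq G) :
  path (@adj G) x s ->
  odd (count (fun f : {set G} => v \in f) (walk_edges x s))
    = (v == x) (+) (v == last x s).
Proof.
elim: s x => [|y s IH] x /=; first by rewrite addbb.
case/andP=> xy ys; rewrite oddD IH // oddb in_set2.
have xNy : x != y by apply: contraTneq xy => ->; rewrite adj_irr.
have -> : (v == x) || (v == y) = (v == x) (+) (v == y).
  by case: eqVneq => // ->; rewrite (negPf xNy).
by rewrite addbA -(addbA (v == x)) addbb addbF.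
Qed.

Lemma count_sum_mem (T : finType) (a : pred T) (w : seq T) :
  count a w = \sum_(f | a f) count_mem f w.
Proof.
elim: w => [|y w IH] /=; first by rewrite big1.
rewrite big_split /= IH; congr addn.
rewrite big_mkcond /= (bigD1 y) //= eqxx big1 ?addn0; first by case: (a y).
by move=> f fy; rewrite eq_sym (negPf fy) if_same.
Qed.

Lemma injective_strong_parity (G : sgraph) (c : {set G} -> nat) :
  injective c -> strong_parity_coloring c.
Proof.
move=> c_inj x s [xs xl ev].
have evf f : ~~ odd (count_mem f (walk_edges x s)).
  have := ev (c f); rewrite count_map.
  by rewrite (eq_count (a2 := pred1 f)) // => g /=; exact: inj_eq.
have := odd_walk_degree x xs; rewrite eqxx (negPf xl) /= count_sum_mem.
apply/negP; elim/big_ind: _ => // m k om ok.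
by rewrite oddD (negPf om) (negPf ok).
Qed.

Lemma ex_strong_parity (G : sgraph) :
  exists k, `[< exists2 c : {set G} -> nat,
                  strong_parity_coloring c & num_colors c = k >].
Proof.
exists (num_colors (fun f : {set G} => enum_rank f : nat)).
apply/asboolP; eexists; last by [].
by apply: injective_strong_parity => f g /val_inj /enum_rank_inj.
Qed.

Lemma ex_parity (G : sgraph) :
  exists k, `[< exists2 c : {set G} -> nat,
                  parity_coloring c & num_colors c = k >].
Proof.
have [k /asboolP[c cS ck]] := ex_strong_parity G.
by exists k; apply/asboolP; exists c => //; exact: strong_parity_coloringW.
Qed.

Definition parity_number (G : sgraph) : nat := ex_minn (ex_parity G).

Definition strong_parity_number (G : sgraph) : nat :=
  ex_minn (ex_strong_parity G).

(* Main.v *)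
(** Write n = #|T| with T = I * bool.  Take a K_{2,n} with hubs h and h', and
    join h by a bridge to a vertex of the n-dimensional cube.  A simple path
    crosses the bridge at most once, so if the bridge has a color of its own,
    the two sides can be colored independently, each with the same n colors;
    the degree of h shows that n + 1 colors are needed.

    A walk, in contrast, can leave the cube, run around cycles of K_{2,n} and
    come back.  In a strong parity edge-coloring with d colors, the parity
    vectors of walks from h to distinct vertices are distinct, so the 2^n
    cube vertices have pairwise disjoint cosets of the space of parity vectors
    of closed walks at h; if that space has dimension l, then n + l <= d.
    Each leaf t of K_{2,n} gives a walk from h to h' with colors x_t, y_t, and
    since t |-> x_t and t |-> y_t are injective, at least a third of the
    leaves give disjoint pairs {x_t, y_t}, whence l >= n/3 - 1. *)

Require Import Defs.
From HB Require Import structures.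
From mathcomp Require Import all_boot all_order all_algebra.
From mathcomp Require Import lra.

Set Implicit Arguments.
Unset Strict Implicit.
Unset Printing Implicit Defensive.
Import Order.TTheory GRing.Theory Num.Theory.
Local Open Scope ring_scope.

(** * Parity vectors of walks under an arbitrary edge-coloring *)

Section Colorings.
Local Open Scope nat_scope.
Variables (G : sgraph) (c : {set G} -> nat).

Definition colors : seq nat := undup [seq c f | f <- enum (edges G)].

Lemma mem_edges (x y : G) : adj x y -> [set x; y] \in edges G.
Proof. by move=> xy; apply/imsetP; exists (x, y); rewrite ?inE. Qed.

Lemma color_edge (x y : G) : adj x y -> c [set x; y] \in colors.
Proof.
by move=> xy; rewrite mem_undup map_f // mem_enum mem_edges.
Qed.

(** Otherwise the two edges at [v] form the parity path [x, v, y]. *)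
Lemma parity_proper (v x y : G) :
  parity_coloring c -> adj v x -> adj v y -> c [set v; x] = c [set v; y] ->
  x = y.
Proof.
move=> cP vx vy cxy; apply/eqP/negPn/negP => xNy.
apply: (cP x [:: v; y]); split=> //=.
- by rewrite adj_sym vx vy.
- rewrite !inE (negPf xNy) orbF andbT; apply/andP; split.
    by apply: contraTneq vx => ->; rewrite adj_irr.
  by apply: contraTneq vy => ->; rewrite adj_irr.
- by move=> a /=; rewrite setUC cxy; case: eqP.
Qed.

Lemma degree_num_colors (v : G) :
  parity_coloring c -> #|[set u | adj v u]| <= num_colors c.
Proof.
move=> cP; rewrite cardE -(size_map (fun u => c [set v; u])).
apply: uniq_leq_size => [|_ /mapP[u + ->]].
  rewrite map_inj_in_uniq ?enum_uniq // => x y.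
  by rewrite !mem_enum !inE; exact: parity_proper.
by rewrite mem_enum inE; exact: color_edge.
Qed.

Definition walk_parity (x y : G) (p : nat -> bool) : Prop :=
  exists s, [/\ path (@adj G) x s, last x s = y
    & forall a, odd (count_mem a [seq c f | f <- walk_edges x s]) = p a].

Lemma eq_walk_parity (x y : G) (p q : nat -> bool) :
  p =1 q -> walk_parity x y p -> walk_parity x y q.
Proof. by move=> pq [s [xs xy sp]]; exists s; split=> // a; rewrite sp. Qed.

Lemma walk_parity_refl (x : G) : walk_parity x x (fun=> false).
Proof. by exists [::]. Qed.

Lemma walk_parity_edge (x y : G) :
  adj x y -> walk_parity x y (pred1 (c [set x; y])).
Proof.
move=> xy; exists [:: y]; split=> [|//|a] /=; first by rewrite xy.
by rewrite addn0 oddb eq_sym.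
Qed.

Lemma walk_parity_trans (y x z : G) (p q : nat -> bool) :
  walk_parity x y p -> walk_parity y z q ->
  walk_parity x z (fun a => p a (+) q a).
Proof.
move=> [s [xs xy sp]] [t [yt yz tq]]; exists (s ++ t); split=> [||a].
- by rewrite cat_path xs xy.
- by rewrite last_cat xy.
- by rewrite /walk_edges pairmap_cat xy map_cat count_cat oddD sp tq.
Qed.

Lemma walk_parity_sym (x y : G) (p : nat -> bool) :
  walk_parity x y p -> walk_parity y x p.
Proof.
case=> s; elim: s x p => [|z s IH] x p [/= xs xy sp].
  by rewrite -xy; apply: eq_walk_parity (walk_parity_refl x).
case/andP: xs => xz zs; have yz := IH z _ (And3 zs xy (fun=> erefl)).
rewrite adj_sym in xz.
apply: eq_walk_parity (walk_parity_trans yz (walk_parity_edge xz)) => a /=.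
by rewrite -sp oddD oddb addbC setUC eq_sym.
Qed.

Lemma walk_parity_colors (x y : G) (p : nat -> bool) (a : nat) :
  walk_parity x y p -> p a -> a \in colors.
Proof.
case=> s [xs _ <-]; elim: s x xs => //= y' s IH x /andP[xy' ys].
have [<- _|_] := eqVneq (c [set x; y']) a; first exact: color_edge.
exact: IH.
Qed.

(** The reverse of the first walk followed by the second has parity vector zero, so it cannot be
    open. *)
Lemma strong_parity_inj (x y z : G) (p : nat -> bool) :
  strong_parity_coloring c -> walk_parity x y p -> walk_parity x z p -> y = z.
Proof.
move=> cS /walk_parity_sym xy xz.
have [s [ys yz sp]] := walk_parity_trans xy xz.
apply/eqP/negPn/negP => yNz; apply: (cS y s); split=> //; first by rewrite yz.
by move=> a; rewrite sp addbb.
Qed.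

(** Keeping only the colors in use leaves [2 ^ num_colors c] possible values, which makes counting
    possible. Nothing is lost, since the parity vector of a walk vanishes on all other colors. *)
Definition color_vector (p : nat -> bool) : {set 'I_(num_colors c)} :=
  [set j : 'I_(num_colors c) | p (nth 0 colors j)].

Lemma color_vector_inj (x y y' : G) (p q : nat -> bool) :
  walk_parity x y p -> walk_parity x y' q ->
  color_vector p = color_vector q -> p =1 q.
Proof.
move=> xp xq pq a; have [aC|aC] := boolP (a \in colors).
  have aN : index a colors < num_colors c by rewrite -index_mem in aC.
  by move/setP/(_ (Ordinal aN)): pq; rewrite !inE /= nth_index.
transitivity false; [|symmetry]; apply: contraNF aC.
  exact: (walk_parity_colors xp).
exact: (walk_parity_colors xq).
Qed.

End Colorings.

Lemma parity_number_le (G : sgraph) (c : {set G} -> nat) :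
  parity_coloring c -> (parity_number G <= num_colors c)%N.
Proof.
move=> cP; rewrite /parity_number; case: ex_minnP => m _; apply.
by apply/boolp.asboolP; exists c.
Qed.

Lemma parity_number_ge (G : sgraph) (m : nat) :
  (forall c : {set G} -> nat, parity_coloring c -> m <= num_colors c)%N ->
  (m <= parity_number G)%N.
Proof.
move=> mP; rewrite /parity_number; case: ex_minnP => k + _.
by move/boolp.asboolP=> [c cP <-]; exact: mP.
Qed.

Lemma strong_parity_number_ge (G : sgraph) (m : nat) :
  (forall c : {set G} -> nat, strong_parity_coloring c ->
     m <= num_colors c)%N ->
  (m <= strong_parity_number G)%N.
Proof.
move=> mP; rewrite /strong_parity_number; case: ex_minnP => k + _.
by move/boolp.asboolP=> [c cP <-]; exact: mP.
Qed.

(** * Selection of leaves with disjoint color pairs *)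

Section Independent.
Local Open Scope nat_scope.
Variable T : finType.

Lemma card_preim_le (f g : T -> nat) (A : {set T}) :
  injective f -> #|[set t | [exists i in A, f t == g i]]| <= #|A|.
Proof.
move=> f_inj; rewrite cardE -(size_map f) [#|A|]cardE -(size_map g).
apply: uniq_leq_size => [|_ /mapP[t + ->]].
  by rewrite map_inj_uniq ?enum_uniq.
rewrite mem_enum inE => /exists_inP[i iA /eqP->].
by rewrite map_f // mem_enum.
Qed.

(** Take [A] maximal. As [f t != g t], every [t] outside [A] clashes with some [i] in [A] through
    [f t = g i] or [g t = f i]. By injectivity each kind of clash accounts for at most [#|A|]
    elements. *)
Lemma independent_third (f g : T -> nat) :
  injective f -> injective g -> (forall t, f t != g t) ->
  exists2 A : {set T}, {in A &, forall i j, f i != g j} & #|T| <= 3 * #|A|.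
Proof.
move=> f_inj g_inj fNg.
pose P (A : {set T}) := [forall i in A, forall j in A, f i != g j].
have P0 : P set0 by apply/forall_inP => i; rewrite inE.
have [A /maxsetP[/forall_inP AP Amax] _] := maxset_exists P0.
have fgA : {in A &, forall i j, f i != g j}.
  by move=> i j /AP/forall_inP/(_ j).
exists A => //.
pose B := [set t | [exists i in A, f t == g i]].
pose C := [set t | [exists i in A, g t == f i]].
have Tcover : [set: T] \subset A :|: B :|: C.
  apply/subsetP => t _; rewrite !in_setU -orbA.
  apply/negPn/negP; rewrite !negb_or => /and3P[tA tB tC].
  suff PtA : P (t |: A).
    by case/negP: tA; rewrite -(Amax _ PtA (subsetUr _ _)) setU11.
  rewrite !inE in tB tC.
  apply/forall_inP => i; rewrite !inE => iA.
  apply/forall_inP => j; rewrite !inE => jA.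
  case/predU1P: iA => [->|iA]; case/predU1P: jA => [->|jA] //.
  - by apply: contraNneq tB => tj; apply/exists_inP; exists j; rewrite // tj.
  - by apply: contraNneq tC => it; apply/exists_inP; exists i; rewrite // it.
  - exact: fgA.
have BA : #|B| <= #|A| by exact: card_preim_le.
have CA : #|C| <= #|A| by exact: card_preim_le.
rewrite -cardsT !mulSn mul0n addn0 addnA.
apply: leq_trans (subset_leq_card Tcover) _.
apply: leq_trans (leq_card_setU _ _) (leq_add _ CA).
exact: leq_trans (leq_card_setU _ _) (leq_add _ BA).
Qed.

End Independent.

(** * The graph made of K_{2,n}, the bridge and the cube, and its parity coloring *)

Section Gadget.
Local Open Scope nat_scope.
Variable I : finType.
Local Notation T := (I * bool)%type.
Local Notation V := ((T + bool) + {set T})%type.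

Definition symdiff (A B : {set T}) : {set T} :=
  [set t | (t \in A) (+) (t \in B)].

Lemma symdiffC (A B : {set T}) : symdiff A B = symdiff B A.
Proof. by apply/setP => t; rewrite !inE addbC. Qed.

(* [inl (inl t)] are the leaves of K_{2,n}, [inl (inr false)] and
   [inl (inr true)] its hubs, and [inr A] the vertices of the cube; the bridge
   joins the hub [false] to [set0]. *)
Definition gadget_adj (u v : V) : bool :=
  match u, v with
  | inl (inl _), inl (inr _) | inl (inr _), inl (inl _) => true
  | inl (inr s), inr A | inr A, inl (inr s) => ~~ s && (A == set0)
  | inr A, inr B => #|symdiff A B| == 1
  | _, _ => false
  end.

Lemma gadget_adj_sym : symmetric gadget_adj.
Proof. by move=> [[t|s]|A] [[t'|s']|A'] //=; rewrite symdiffC. Qed.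

Lemma gadget_adj_irr : irreflexive gadget_adj.
Proof.
move=> [[t|s]|A] //=; rewrite (_ : symdiff A A = set0) ?cards0 //.
by apply/setP => t; rewrite !inE addbb.
Qed.

Definition gadget : sgraph := SGraph gadget_adj_sym gadget_adj_irr.

Lemma gadget_bipartite : bipartite gadget.
Proof.
exists [set v : V | match v with
                    | inl (inl _) => false
                    | inl (inr _) => true
                    | inr A => odd #|A|
                    end] => u v.
rewrite !inE; case: u v => [[t|s]|A] [[t'|s']|B] //=.
- by case/andP=> _ /eqP->; rewrite cards0.
- by case/andP=> _ /eqP->; rewrite cards0.
move=> /cards1P[t AB].
have sd r : (r \in A) (+) (r \in B) = (r == t).
  by move/setP/(_ r): AB; rewrite !inE.
have AB' : A :\ t = B :\ t.
  apply/setP => r; rewrite !inE; have := sd r.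
  by case: (r == t) => //=; case: (r \in A); case: (r \in B).
rewrite (cardsD1 t A) (cardsD1 t B) AB'.
have := sd t; rewrite eqxx !oddD !oddb.
by case: (t \in A); case: (t \in B); case: (odd _).
Qed.

(* [None] is the color of the bridge.  A leaf [t] receives the color [t] from
   one hub and the color of its twin from the other: this is a strong
   parity coloring of K_{2,n}. *)
Definition gadget_col (u v : V) : option T :=
  match u, v with
  | inl (inl (i, b)), inl (inr s) | inl (inr s), inl (inl (i, b)) =>
      Some (i, b (+) s)
  | inr A, inr B => [pick t in symdiff A B]
  | _, _ => None
  end.

Lemma gadget_colC (u v : V) : gadget_col u v = gadget_col v u.
Proof.
by case: u v => [[[i b]|s]|A] [[[i' b']|s']|B] //=; rewrite symdiffC.
Qed.

(** An edge is an unordered pair, so [pick] chooses an order of its ends; the symmetry of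
    [gadget_col] makes the choice harmless. *)
Definition gadget_coloring (f : {set gadget}) : nat :=
  enum_rank (if [pick p : V * V | f == [set p.1; p.2]] is Some p
             then gadget_col p.1 p.2 else None).

Lemma eq_set2 (W : finType) (x y u v : W) : [set x; y] = [set u; v] ->
  x = u /\ y = v \/ x = v /\ y = u.
Proof.
move=> E; move/setP: E => E.
have := E x; have := E y; have := E u; have := E v; rewrite !inE !eqxx /= ?orbT.
move=> /pred2P hv /pred2P hu /esym/pred2P hy /esym/pred2P hx.
case: hx => hx; case: hy => hy; subst; try by [left|right].
  by case: hv => ->; left.
by case: hu => ->; left.
Qed.

Lemma gadget_coloringE (u v : V) :
  gadget_coloring [set u; v] = enum_rank (gadget_col u v).
Proof.
rewrite /gadget_coloring; case: pickP => [[x y] /eqP|/(_ (u, v))] /=.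
  by case/eq_set2=> -[-> ->] //; rewrite gadget_colC.
by rewrite eqxx.
Qed.

Lemma even_colors_count (P : pred (option T)) (x : gadget) (s : seq gadget) :
  even_colors gadget_coloring x s -> ~~ odd (count P (pairmap gadget_col x s)).
Proof.
move=> ev.
have colE : [seq gadget_coloring f | f <- walk_edges x s]
    = [seq (enum_rank o : nat) | o <- pairmap gadget_col x s].
  by elim: s x {ev} => //= y s IH x; rewrite gadget_coloringE IH.
rewrite count_sum_mem; elim/big_ind: _ => [//|m k om ok|o _].
  by rewrite oddD (negPf om) (negPf ok).
have := ev (enum_rank o); rewrite colE count_map.
rewrite (eq_count (a2 := pred1 o)) // => o' /=.
by rewrite (inj_eq val_inj) (inj_eq enum_rank_inj).
Qed.

(** The potential [g] flips exactly along the edges with color in [P], and a walk with even colors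
    has an even number of these. The domain [D] allows potentials that behave so on one side of the
    bridge only. *)
Lemma parity_invariant (D : pred V) (P : pred (option T)) (g : V -> bool)
    (x : gadget) (s : seq gadget) :
  {in D &, forall u v, gadget_adj u v -> P (gadget_col u v) = g u (+) g v} ->
  path (@adj gadget) x s -> all D (x :: s) ->
  even_colors gadget_coloring x s -> g x = g (last x s).
Proof.
move=> Pg xs Dxs /(@even_colors_count P) ev.
suff E : odd (count P (pairmap gadget_col x s)) = g x (+) g (last x s).
  by move: ev; rewrite E; case: (g x); case: (g _).
elim: s x xs Dxs {ev} => [|y s IH] x /=; first by rewrite addbb.
move=> /andP[xy ys] /and3P[Dx Dy Ds]; rewrite oddD IH //=; last by rewrite Dy.
by rewrite Pg // oddb addbA -(addbA (g x)) addbb addbF.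
Qed.

Definition in_cube (v : V) : bool := if v is inr _ then true else false.

Definition bridge_end (b : bool) : V :=
  if b then inr set0 else inl (inr false).

Lemma adj_bridge (u v : V) : gadget_adj u v -> in_cube u != in_cube v ->
  u = bridge_end (in_cube u) /\ v = bridge_end (in_cube v).
Proof.
by case: u v => [[t|[]]|A] [[t'|[]]|B] //= /eqP->.
Qed.

(** A walk can change sides only by stepping onto the far end of the bridge. *)
Lemma path_one_side (y : gadget) (s : seq gadget) :
  path (@adj gadget) y s -> bridge_end (~~ in_cube y) \notin s ->
  all (fun v => in_cube v == in_cube y) s.
Proof.
elim: s y => //= z s IH y /andP[yz zs]; rewrite inE negb_or => /andP[zN sN].
have zy : in_cube z = in_cube y.
  apply/eqP/negPn/negP => zy; have [|_ zE] := adj_bridge yz; first by rewrite eq_sym.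
  by case/eqP: zN; rewrite [RHS]zE; case: (in_cube z) (in_cube y) zy => -[].
by rewrite zy eqxx /= -zy IH // zy.
Qed.

(** After crossing the bridge, a return would have to visit its first end again. *)
Lemma simple_path_one_side (x : gadget) (s : seq gadget) :
  path (@adj gadget) x s -> uniq (x :: s) -> in_cube (last x s) = in_cube x ->
  all (fun v => in_cube v == in_cube x) s.
Proof.
elim: s x => //= y s IH x /andP[xy ys] /and3P[xN yN us] lx.
have [yx|yx] := eqVneq (in_cube y) (in_cube x).
  by rewrite /= -yx IH //= ?yN ?us // yx.
have [|xE _] := adj_bridge xy; first by rewrite eq_sym.
have xE' : x = bridge_end (~~ in_cube y).
  by rewrite [LHS]xE; case: (in_cube y) (in_cube x) yx => -[].
have sN : bridge_end (~~ in_cube y) \notin s.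
  by rewrite -xE'; apply: contra xN; rewrite inE => ->; rewrite orbT.
have sy : all (fun v => in_cube v == in_cube y) (y :: s).
  by rewrite /= eqxx path_one_side.
by have := allP sy _ (mem_last y s); rewrite lx eq_sym (negPf yx).
Qed.

(** Invariants recover the last vertex from the first. The bridge has a color of its own, so both
    ends lie on the same side, and a simple path then never leaves that side. There, further
    potentials determine the vertex. *)
Lemma gadget_parity_coloring : parity_coloring gadget_coloring.
Proof.
move=> x s [xs us s0 ev].
suff E : x = last x s.
  case: s s0 us E {xs ev} => //= y s _ /andP[xN _] E.
  by rewrite E mem_last in xN.
have lx : in_cube (last x s) = in_cube x.
  apply/esym/(@parity_invariant predT (pred1 None) in_cube _ _ _ xs _ ev).
    move=> [[[i b]|p]|A] [[[i' b']|p']|B] _ _ //=.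
    by move=> /cards1P[t ->]; case: pickP => // /(_ t); rewrite !inE eqxx.
  exact: all_predT.
have Dxs : all (fun v => in_cube v == in_cube x) (x :: s).
  by rewrite /= eqxx simple_path_one_side.
have inv P g Pg := @parity_invariant _ P g x s Pg xs Dxs ev.
case: x {us xs ev s0} lx Dxs inv => [u|A].
  case: (last _ s) => [v _ _ inv|//].
  (* The end vertex is determined by the pair it belongs to and by its bit. *)
  have gi i := inv (fun o => if o is Some (i', _) then i' == i else false)
    (fun v => if v is inl (inl (i', _)) then i' == i else false).
  have gb := inv (fun o => if o is Some (_, b) then b else false)
    (fun v => match v with inl (inl (_, b)) => b | inl (inr p) => p
              | _ => false end).
  case: u v gi gb {inv} => [[i b]|p] [[i' b']|p'] gi gb.
  - rewrite (_ : b = b'); last first.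
      by apply: gb => -[[[? ?]|?]|?] [[[? ?]|?]|?] //= _ _ _; rewrite addbC.
    suff /eqP-> : i' == i by [].
    apply/esym; rewrite -(eqxx i).
    by apply: gi => -[[[? ?]|?]|?] [[[? ?]|?]|?] //= _ _ _; rewrite addbF.
  - suff : i == i = false by rewrite eqxx.
    by apply: gi => -[[[? ?]|?]|?] [[[? ?]|?]|?] //= _ _ _; rewrite addbF.
  - suff : false = (i' == i') by rewrite eqxx.
    by apply: gi => -[[[? ?]|?]|?] [[[? ?]|?]|?] //= _ _ _; rewrite addbF.
  - rewrite (_ : p = p') //.
    by apply: gb => -[[[? ?]|?]|?] [[[? ?]|?]|?] //= _ _ _; rewrite addbC.
case: (last _ s) => [//|B _ _ inv]; congr inr; apply/setP => t.
(* In the cube, an edge has color [t] exactly when it changes membership of [t]. *)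
apply: (inv (pred1 (Some t)) (fun v => if v is inr A then t \in A else false)).
move=> [?|A'] [?|B'] //= _ _ /cards1P[r AB].
have <- : (t \in symdiff A' B') = (t \in A') (+) (t \in B') by rewrite inE.
rewrite AB; case: pickP => [q|/(_ r)]; rewrite !inE ?eqxx // => /eqP->.
by rewrite eq_sym.
Qed.

Lemma num_gadget_coloring : num_colors gadget_coloring <= #|{: T}|.+1.
Proof.
rewrite -card_option -(size_iota 0 #|_|).
apply: uniq_leq_size; first exact: undup_uniq.
by move=> a; rewrite mem_undup => /mapP[f _ ->]; rewrite mem_iota add0n ltn_ord.
Qed.

(** The lower bound is the degree of the hub [false]: all leaves, and the vertex [set0] across the
    bridge. *)
Lemma parity_number_gadget : parity_number gadget = #|{: T}|.+1.
Proof.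
apply/eqP; rewrite eqn_leq; apply/andP; split.
  exact: leq_trans (parity_number_le gadget_parity_coloring) num_gadget_coloring.
apply: parity_number_ge => c cP.
apply: leq_trans (degree_num_colors (inl (inr false) : gadget) cP).
pose nb (o : option T) : V := if o is Some t then inl (inl t) else inr set0.
have nb_inj : injective nb by move=> [t|] [t'|] //= [->].
rewrite -card_option -(card_imset _ nb_inj); apply: subset_leq_card.
by apply/subsetP => _ /imsetP[[t|] _ ->]; rewrite inE /= ?eqxx.
Qed.

(** * The lower bound for strong parity edge-colorings *)

Section Lower.
Variable c : {set gadget} -> nat.

Lemma walk_to_cube (s : bool) (t0 : T) (A : {set T}) :
  exists p, walk_parity c (inl (inr s)) (inr A) p.
Proof.
elim: {A}#|A| {-2}A (erefl #|A|) => [|m IH] A cA.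
  (* The detour through [t0] brings either hub to the hub [false]; for [s = false] it goes to the
     leaf and back, so both cases are uniform. *)
  have e1 : @adj gadget (inl (inr s)) (inl (inl t0)) by [].
  have e2 : @adj gadget (inl (inl t0)) (inl (inr false)) by [].
  have e3 : @adj gadget (inl (inr false)) (inr set0) by rewrite /= eqxx.
  rewrite (cards0_eq cA); eexists.
  apply: walk_parity_trans (walk_parity_edge c e1) _.
  exact: walk_parity_trans (walk_parity_edge c e2) (walk_parity_edge c e3).
have [t tA] : exists t, t \in A by apply/card_gt0P; rewrite cA.
have [p Ap] : exists p, walk_parity c (inl (inr s)) (inr (A :\ t)) p.
  by apply: IH; move: cA; rewrite (cardsD1 t) tA => -[].
have e : @adj gadget (inr (A :\ t)) (inr A).
  rewrite /= (_ : symdiff _ _ = [set t]) ?cards1 //.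
  apply/setP => r; rewrite !inE; have [->|] := eqVneq r t; first by rewrite tA.
  by rewrite addbb.
by eexists; exact: walk_parity_trans Ap (walk_parity_edge c e).
Qed.

Definition hub_color (s : bool) (t : T) : nat :=
  c ([set inl (inr s); inl (inl t)] : {set gadget}).

(* The parity vector of a walk from the hub [false] that alternates between
   the hubs and visits the leaves in [J]. *)
Definition zigzag (J : {set T}) (a : nat) : bool :=
  \big[addb/false]_(t in J) ((a == hub_color false t) (+) (a == hub_color true t)).

Lemma walk_zigzag (J : {set T}) :
  walk_parity c (inl (inr false)) (inl (inr (odd #|J|))) (zigzag J).
Proof.
elim: {J}#|J| {-2}J (erefl #|J|) => [|m IH] J cJ.
  rewrite (cards0_eq cJ) cards0; apply: eq_walk_parity (walk_parity_refl _ _).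
  by move=> a; rewrite /zigzag big_set0.
have [t tJ] : exists t, t \in J by apply/card_gt0P; rewrite cJ.
have cJt : #|J :\ t| = m by move: cJ; rewrite (cardsD1 t) tJ => -[].
have Jt := IH _ cJt; rewrite cJt in Jt.
(* The walk for [J :\ t] ends at the hub [odd m]; passing through [t] leads to the other hub. *)
have e1 : @adj gadget (inl (inr (odd m))) (inl (inl t)) by [].
have e2 : @adj gadget (inl (inl t)) (inl (inr (~~ odd m))) by [].
have := walk_parity_trans (walk_parity_edge c e1) (walk_parity_edge c e2).
move/(walk_parity_trans Jt); rewrite cJ /=; apply: eq_walk_parity => a /=.
rewrite /zigzag [RHS](big_setD1 t) //= addbC /hub_color; congr addb.
rewrite [X in _ (+) (_ == c X)]setUC.
by case: (odd m) => //=; rewrite addbC.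
Qed.

(** Within [A], the color [hub_color false t] occurs at no other leaf and on no edge to the hub
    [true], so its parity tells whether [t] was visited. *)
Lemma zigzag_inj (A : {set T}) : injective (hub_color false) ->
  {in A &, forall i j, hub_color true i != hub_color false j} ->
  {in [set J : {set T} | J \subset A] &, forall J K, zigzag J =1 zigzag K -> J = K}.
Proof.
move=> f_inj fg J K; rewrite !inE => JA KA JK.
suff zE (L : {set T}) : L \subset A ->
    {in A, forall t, zigzag L (hub_color false t) = (t \in L)}.
  apply/setP => t; have [tA|tA] := boolP (t \in A).
    by rewrite -(zE J) // -(zE K).
  by rewrite (negPf (contra (subsetP JA t) tA)) (negPf (contra (subsetP KA t) tA)).
move=> LA t tA; rewrite /zigzag.
rewrite (eq_bigr (fun r => r == t)) => [|r rL]; last first.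
  rewrite (inj_eq f_inj) [X in _ (+) X]eq_sym.
  by rewrite (negPf (fg _ _ _ tA)) ?(subsetP LA) // addbF eq_sym.
have [tL|tL] := boolP (t \in L).
  by rewrite (big_setD1 t) //= eqxx big1 // => r; rewrite !inE => /andP[/negPf].
by rewrite big1 // => r rL; apply: contraNF tL => /eqP<-.
Qed.

(** Count pairs of a cube vertex [B] and a set [J] of leaves in [A], with [m = #|A|]. The vector of
    a walk that zigzags along [J] and then goes to [B] determines [B], and with the parity of [#|J|]
    also [J]; hence [2 ^ (n + m)] pairs embed into [2 ^ (num_colors c + 1)] values. *)
Lemma strong_gadget_colors (t0 : T) : strong_parity_coloring c ->
  exists2 m, #|{: T}| <= 3 * m & #|{: T}| + m <= (num_colors c).+1.
Proof.
move=> cS; have cP := strong_parity_coloringW cS.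
have hub_inj s : injective (hub_color s).
  move=> t r tr; suff [] : (inl (inl t) : gadget) = inl (inl r) by [].
  exact: (parity_proper (v := inl (inr s) : gadget) cP).
have hubN t : hub_color true t != hub_color false t.
  apply/eqP; rewrite /hub_color ![[set _; inl (inl t)]]setUC => E.
  by have := parity_proper (v := inl (inl t) : gadget) (x := inl (inr true))
    (y := inl (inr false)) cP isT isT E.
have [A Aind A3] := independent_third (hub_inj true) (hub_inj false) hubN.
exists #|A| => //.
(* One walk is fixed for each hub and each cube vertex. Sets [J] of equal parity thus share the
   second half of their walks, and its vector cancels when two of them are compared. *)
have /fin_all_exists[p pP] (sB : bool * {set T}) :
  exists q, walk_parity c (inl (inr sB.1)) (inr sB.2) q by exact: walk_to_cube.
pose w (B J : {set T}) a := zigzag J a (+) p (odd #|J|, B) a.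
have wP B J : walk_parity c (inl (inr false)) (inr B) (w B J).
  exact: walk_parity_trans (walk_zigzag J) (pP (_, B)).
(* [walk_zigzag] ends at either hub, according to the parity of [#|J|]; recording
   that parity costs one bit. *)
pose F (BJ : {set T} * {set T}) := (odd #|BJ.2|, color_vector c (w BJ.1 BJ.2)).
have F_inj : {in setX [set: {set T}] (powerset A) &, injective F}.
  move=> [B J] [B' J'] /setXP[_]; rewrite inE => JA /setXP[_]; rewrite inE => JA'.
  case=> Jodd /(color_vector_inj (wP B J) (wP B' J')) wE.
  have [BB'] : (inr B : gadget) = inr B'.
    exact: strong_parity_inj cS (eq_walk_parity wE (wP B J)) (wP B' J').
  subst B'; congr pair; apply: (zigzag_inj (hub_inj false) Aind); rewrite ?inE // => a.
  by have := wE a; rewrite /w Jodd => /addIb.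
rewrite -(leq_exp2l (m := 2)) // expnD expnS.
have <- : #|setX [set: {set T}] (powerset A)| = 2 ^ #|{: T}| * 2 ^ #|A|.
  by rewrite cardsX card_powerset -powersetT card_powerset cardsT.
rewrite -(card_in_imset F_inj) (leq_trans (max_card _)) //.
by rewrite card_prod card_bool -cardsT -powersetT card_powerset cardsT card_ord.
Qed.

End Lower.
End Gadget.

(** * The graph for [n = 1] *)

Section Cherry.
Local Open Scope nat_scope.

(** The path with two edges and middle vertex [None]. *)
Definition cherry_adj (u v : option bool) : bool := (u == None) != (v == None).

Lemma cherry_adj_sym : symmetric cherry_adj.
Proof. by move=> u v; rewrite /cherry_adj eq_sym. Qed.

Lemma cherry_adj_irr : irreflexive cherry_adj.
Proof. by move=> u; rewrite /cherry_adj eqxx. Qed.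

Definition cherry : sgraph := SGraph cherry_adj_sym cherry_adj_irr.

Lemma cherry_bipartite : bipartite cherry.
Proof. by exists [set (None : cherry)] => u v; rewrite !inE. Qed.

Lemma cherry_degree : #|[set u : cherry | adj (None : cherry) u]| = 2.
Proof.
rewrite (_ : [set u | _] = [set: option bool] :\ None).
  by have := cardsD1 None [set: option bool]; rewrite cardsT card_option card_bool inE => -[->].
by apply/setP => -[u|]; rewrite !inE.
Qed.

Lemma parity_number_cherry : parity_number cherry = 2.
Proof.
apply/eqP; rewrite eqn_leq; apply/andP; split; last first.
  by apply: parity_number_ge => c /(degree_num_colors (None : cherry)); rewrite cherry_degree.
pose c (f : {set cherry}) : nat := enum_rank f.
have cS : strong_parity_coloring c.
  by apply: injective_strong_parity => f g /val_inj/enum_rank_inj.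
apply: leq_trans (parity_number_le (strong_parity_coloringW cS)) _.
apply: leq_trans (size_undup _) _; rewrite size_map -cardE.
apply: (@leq_trans #|[set [set None; Some true]; [set None; Some false]] : {set {set cherry}}|);
  last by rewrite cards2; case: (_ != _).
apply: subset_leq_card; apply/subsetP => f /imsetP[[u v]].
rewrite inE => /= uv ->; rewrite !inE.
case: u v uv => [[]|] [[]|] //= _; rewrite ?eqxx ?orbT //.
  by rewrite setUC eqxx.
by rewrite setUC eqxx orbT.
Qed.

End Cherry.

Theorem theorem5p2 (n : nat) (hn : exists k : nat, n = (2 ^ (2 * k))%N) :
  exists G : sgraph,
    [/\ bipartite G,
        parity_number G = (n + 1)%N
      & n%:R - (trunc_log 2 n)%:R + (trunc_log 2 n)%:R ^+ 2 / 4
          < (strong_parity_number G)%:R :> rat].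
Proof.
case: hn => -[|k] ->.
  (* n = 1 is odd, so the leaves do not come in pairs. *)
  exists cherry; split; first exact: cherry_bipartite.
    exact: parity_number_cherry.
  have : (2 <= strong_parity_number cherry)%N.
    apply: strong_parity_number_ge => c /strong_parity_coloringW.
    by move/(degree_num_colors (None : cherry)); rewrite cherry_degree.
  rewrite muln0 expn0 trunc_log1 expr0n /= mul0r subr0 addr0 => ?.
  by rewrite ltr_nat.
have eT : #|{: 'I_(2 ^ (2 * k).+1) * bool}| = (2 ^ (2 * k.+1))%N.
  by rewrite card_prod card_ord card_bool -expnSr mulnS.
exists (gadget 'I_(2 ^ (2 * k).+1)); split; first exact: gadget_bipartite.
  by rewrite parity_number_gadget eT addn1.
rewrite trunc_expnK //.
(* As the logarithm of [n] is [2 * (k + 1)], the bound in question equals [n + k ^ 2 - 1]. *)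
have : (2 ^ (2 * k.+1) + k ^ 2 <= strong_parity_number (gadget 'I_(2 ^ (2 * k).+1)))%N.
  apply: strong_parity_number_ge => c cS.
  have t0 : 'I_(2 ^ (2 * k).+1) * bool.
    by split; [apply: (@Ordinal _ 0); rewrite expn_gt0 | exact: true].
  have [m m3 md] := strong_gadget_colors t0 cS; rewrite eT in m3 md.
  rewrite -ltnS; apply: leq_trans md; rewrite ltn_add2l.
  (* Since [n = 4 * 4 ^ k], this gives [3 * k ^ 2 < n <= 3 * m]. The strict [k ^ 2 < m] makes up for
     the bit lost in [n + m <= num_colors c + 1]. *)
  have k2 : (k ^ 2 < 2 ^ (2 * k))%N by rewrite mulnC expnM ltn_exp2r // ltn_expl.
  rewrite -(ltn_pmul2l (m := 3)) //; apply: leq_trans m3.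
  rewrite mulnS expnD; apply: leq_trans (_ : 3 * 2 ^ (2 * k) <= _)%N.
    by rewrite ltn_pmul2l.
  by rewrite leq_mul2r orbT.
set s := strong_parity_number _; rewrite -(ler_nat rat) natrD !natrX => le_s.
apply: lt_le_trans le_s.
by rewrite natrM -natr1; lra.
Qed.
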